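(* Let $s\in\mathbb{C}$, with $\sigma=\Re(s)$, and $0\le x<1$ be fixed. The function $\varphi(z,s,x)=\sum_{n=1}^{\infty}z^n(a_n+x)^{-s}$, understood as a function of the variable $z$, which defines a holomorphic function in the open disk $|z|<\rho$ for $\rho=\alpha_1^{\sigma}$, has an analytic continuation to a meromorphic function of the whole $z$-plane. Its poles are all simple and lie at the points $$z^{(s)}_{j,k_1,\dots,k_{r-1}}=\alpha_1^{s+j+k_1}\alpha_2^{-k_1+k_2}\cdots\alpha_{r-1}^{-k_{r-2}+k_{r-1}}\alpha_r^{-k_{r-1}},\qquad j,k_i\in\mathbb{Z}_{\ge 0},\quad k_1\ge\dots\ge k_{r-1}.$$
   Context: Setting: $\{a_n\}_{n\ge 1}$ is a linear recurrence sequence over $\mathbb{Z}$, i.e. a sequence of integers for which there is a monic $Q\in\mathbb{Z}[X]$ with $Q(\nabla)a_n=0$ for all $n$, where $\nabla a_n=a_{n+1}$. Its minimal polynomial $P\in\mathbb{Z}[X]$ (the monic polynomial of least degree with $P(\nabla)$ annihilating $\{a_n\}$) is assumed irreducible over $\mathbb{Q}$, of degree $r$, with (simple) roots $\alpha_1,\dots,\alpha_r\in\mathbb{C}$, and $\alpha_1$ is a dominant root: $\alpha_1$ is real, $\alpha_1>1$ and $\alpha_1>|\alpha_i|$ for $i=2,\dots,r$. The sequence $\{a_n\}$ is assumed to be a strictly increasing sequence of positive integers. Complex powers of the positive reals $a_n+x$ and $\alpha_1$ are defined through the real logarithm. With the convention $k_r=0$, $z^{(s)}_{j,k_1,\dots,k_{r-1}}=\alpha_1^{s+j+k_1}\prod_{i=2}^r\alpha_i^{k_i-k_{i-1}}$.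 *)

(* Defs.v *)
From HB Require Import structures.
From mathcomp Require Import all_boot all_order all_algebra.
From mathcomp Require Import complex.
From mathcomp Require Import all_classical all_reals all_analysis.

Set Implicit Arguments.
Unset Strict Implicit.
Unset Printing Implicit Defensive.
Import Order.TTheory GRing.Theory Num.Theory.
Import numFieldNormedType.Exports.

Local Open Scope classical_set_scope.
Local Open Scope ring_scope.
Local Open Scope complex_scope.

(* Sequences are indexed from 1: the value [a 0] is never used. *)
Definition annihilates (Q : {poly int}) (a : nat -> int) : Prop :=
  forall n, (1 <= n)%N -> \sum_(i < size Q) Q`_i * a (n + i)%N = 0.

Definition is_min_rec_poly (P : {poly int}) (a : nat -> int) : Prop :=
  [/\ P \is monic, annihilates P a &
      forall Q : {poly int},
        Q \is monic -> annihilates Q a -> (size P <= size Q)%N].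

Section Complex.
Variable R : realType.

(* [R[i]^o] is [R[i]] with its topology of normed space over itself, so that
   [derivable f z 1] is complex differentiability of [f] at [z]. *)
Local Notation C := (R[i]^o).

Definition cexp (w : R[i]) : R[i] :=
  (expR (complex.Re w))%:C * (cos (complex.Im w) +i* sin (complex.Im w)).

(* [t ^ w], relevant only for [0 < t]. *)
Definition rcpow (t : R) (w : R[i]) : R[i] := cexp (w * (ln t)%:C).

Definition phi_term (a : nat -> int) (s : R[i]) (x : R) (z : R[i]) (n : nat) :
  R[i] := z ^+ n * rcpow ((a n)%:~R + x) (- s).

Definition phi_psum (a : nat -> int) (s : R[i]) (x : R) (z : R[i]) (N : nat) :
  C := \sum_(1 <= n < N) phi_term a s x z n.

Definition phi (a : nat -> int) (s : R[i]) (x : R) (z : C) : C :=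
  limn (phi_psum a s x z).

Definition holomorphic_on (U : set C) (f : C -> C) : Prop :=
  forall z, U z -> derivable f z 1.

Definition pole_of_order (f : C -> C) (n : nat) (p : C) : Prop :=
  (0 < n)%N /\
  exists g : C -> C, [/\ \forall z \near p, derivable g z 1, g p != 0 &
    \forall z \near p^', f z = g z / (z - p) ^+ n].

(* The value of [f] at a pole is arbitrary. *)
Definition meromorphic (f : C -> C) : Prop :=
  exists S : set C, [/\ limit_point S = set0, holomorphic_on (~` S) f &
    forall p, S p -> exists n, pole_of_order f n p].

(* [k i] is used only for [1 <= i <= r]; the convention [k r = 0] also covers
   [r = 1], where the family [k_1, ..., k_(r-1)] is empty. *)
Definition pole_index (r : nat) (k : nat -> nat) : Prop :=
  k r = 0%N /\ forall i, (1 <= i < r)%N -> (k i.+1 <= k i)%N.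

Definition pole_point (r : nat) (alpha1 : R) (alpha : nat -> R[i]) (s : R[i])
    (j : nat) (k : nat -> nat) : R[i] :=
  rcpow alpha1 (s + j%:R + (k 1%N)%:R) *
  \prod_(2 <= i < r.+1) alpha i ^ ((k i)%:Z - (k i.-1)%:Z).

End Complex.

(* Main.v *)
Require Import Defs.
From HB Require Import structures.
From mathcomp Require Import all_boot all_order all_algebra.
From mathcomp Require Import separable complex.
From mathcomp Require Import all_classical all_reals all_analysis.
From mathcomp Require Import ring lra.

Set Implicit Arguments.
Unset Strict Implicit.
Unset Printing Implicit Defensive.
Import Order.TTheory GRing.Theory Num.Theory.
Import numFieldNormedType.Exports.

Local Open Scope classical_set_scope.
Local Open Scope ring_scope.
Local Open Scope complex_scope.

(** Write alpha_1 > 1 for the dominant root.  As the minimal polynomial is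
irreducible, its roots are simple and nonzero, so
a_n = sum_i c_i alpha_i^n, and no c_i vanishes: c_i is, up to a nonzero factor,
the value at alpha_i of a rational polynomial of degree < r whose leading
coefficient is a_1, and such a polynomial has no root in common with the
irreducible one (exponential_form).  Positivity of the a_n then forces
c_1 > 0, and
  a_n + x = c_1 alpha_1^n (1 + u_n),
where u_n is real, tends geometrically to 0 and is a finite combination of
n-th powers of the ratios alpha_i / alpha_1 (i >= 2) and 1 / alpha_1.

Expanding (1 + u)^(-s) by Taylor's formula to order M (rcpow_taylor) shows that
(a_n + x)^(-s) is, for every M, a finite combination of n-th powers w^n up to
an error O(eps_M^n), where eps_M tends to 0 and every w is alpha_1^(-s) times a
monomial in those ratios (block_remainder).  Passing from M to M + 1 only adds
terms with |w| <= eps_M.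

Each exponential b w^n contributes b / (1 - z w) to the generating series, and
the error contributes a power series that converges for |z| < 1 / eps_M.  Their
sum is a function on that disc with at most simple poles at points 1 / w.  For
successive M these functions agree wherever both make sense, simply because the
newly subtracted terms are geometric series that converge there
(partial_continuation_le); hence they glue to a function on the whole plane
(continuation).  Holomorphy of power series is obtained by a direct majorization of
the first-order Taylor remainder (derivable_gsum).

Around every point p the glued function is B / (p - z) + g(z) with g holomorphic
near p.  Several w may equal 1 / p, and B, which collects all of them, may
vanish; the singularity is then removable.  If B <> 0 the pole is simple and p
is some 1 / w (continuation_simple, simple_at_order), and solving p w = 1 for
the monomial w gives the announced points (pole_pointE). *)

(** * Power series with geometrically bounded coefficients *)

(** The remainder satisfies the same recurrence in n as its real counterpart, with
|z|, d for z, h; the factor (|h| / d)^2 keeps the bound geometric in n. *)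
Lemma expr_taylor1_le (K : numFieldType) (z h d : K) n : 0 <= d -> `|h| <= d ->
  d ^+ 2 * `|(z + h) ^+ n - z ^+ n - z ^+ n.-1 *+ n * h| <=
  `|h| ^+ 2 * (`|z| + d) ^+ n.
Proof.
move=> d0 hd.
have step (y k : K) m : (y + k) ^+ m.+1 - y ^+ m.+1 - y ^+ m *+ m.+1 * k =
  (y + k) * ((y + k) ^+ m - y ^+ m - y ^+ m.-1 *+ m * k) + y ^+ m.-1 *+ m * k ^+ 2.
  case: m => [|m]; first by rewrite !mulr0n !expr0 !expr1 mulr1n; ring.
  rewrite /= -[_ *+ m.+2]mulr_natr -[_ *+ m.+1]mulr_natr [m.+2%:R]mulrSr.
  by rewrite !exprS; ring.
suff : d ^+ 2 * `|(z + h) ^+ n - z ^+ n - z ^+ n.-1 *+ n * h| <=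
   `|h| ^+ 2 * ((`|z| + d) ^+ n - `|z| ^+ n - `|z| ^+ n.-1 *+ n * d).
  move=> /le_trans; apply; rewrite ler_wpM2l ?exprn_ge0//.
  rewrite -addrA -opprD gerBl addr_ge0 ?exprn_ge0//.
  by rewrite mulr_ge0// mulrn_wge0// exprn_ge0.
elim: n => [|n IH].
  by rewrite !expr0 !mulr0n !mul0r !subrr normr0 !mulr0.
rewrite ![in X in _ <= X]step ![in X in X <= _]step.
rewrite (le_trans (ler_wpM2l (exprn_ge0 2 d0) (ler_normD _ _)))//.
rewrite [leLHS]mulrDr [leRHS]mulrDr lerD//.
  rewrite normrM mulrCA [leRHS]mulrCA.
  rewrite ler_pM ?mulr_ge0 ?exprn_ge0//.
  by rewrite (le_trans (ler_normD _ _))// lerD.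
by rewrite normrM normrMn !normrX mulrCA [leRHS]mulrCA [X in _ * X <= _]mulrC.
Qed.


(** Convexity of r -> r^n, used to dominate the termwise derivative of a power
series by a geometric series. *)
Lemma expr_tangent_le (K : numFieldType) (r d : K) n : 0 <= r -> 0 <= d ->
  r ^+ n.-1 *+ n * d + r ^+ n <= (r + d) ^+ n.
Proof.
move=> r0 d0; elim: n => [|n IH]; first by rewrite mulr0n mul0r add0r.
rewrite [leRHS]exprS (le_trans _ (ler_wpM2l (addr_ge0 r0 d0) IH))// -subr_ge0.
set y := (X in 0 <= X); suff -> : y = r ^+ n.-1 *+ n * d ^+ 2.
  by rewrite mulr_ge0 ?mulrn_wge0 ?exprn_ge0.
rewrite /y /=; case: n {IH y} => [|n]; first by rewrite mulr0n mulr1n; ring.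
rewrite /= -[_ *+ n.+2]mulr_natr -[_ *+ n.+1]mulr_natr [n.+2%:R]mulrSr.
by rewrite !exprS; ring.
Qed.

Lemma geometric_sum_le (K : numFieldType) (q : K) N : 0 <= q < 1 ->
  \sum_(0 <= n < N) q ^+ n <= (1 - q)^-1.
Proof.
move=> /andP[q0 q1]; have q1' : 0 < 1 - q by rewrite subr_gt0.
rewrite -(ler_pM2l q1') mulfV ?gt_eqF// big_mkord.
have -> : (1 - q) * \sum_(i < N) q ^+ i = 1 - q ^+ N.
  by rewrite -opprB mulNr -subrX1 opprB.
by rewrite gerBl exprn_ge0.
Qed.

Lemma derivable_taylor1 (K : numFieldType) (f : K^o -> K^o) (z l d B : K) :
  0 < d ->
  (forall h, `|h| < d -> `|f (z + h) - f z - l * h| <= B * `|h| ^+ 2) ->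
  derivable f z 1.
Proof.
move=> d0 fB; apply/cvg_ex; exists l; apply/cvgrPdist_lt => /= eps eps0.
have B1 : 0 < `|B| + 1 by rewrite ltr_wpDl.
have e0 : 0 < eps / (`|B| + 1) by rewrite divr_gt0.
near=> h.
have h0 : h != 0 by near: h; exact: nbhs_dnbhs_neq.
have hd : `|h| < d by near: h; apply: dnbhs0_lt.
have he : `|h| < eps / (`|B| + 1) by near: h; apply: dnbhs0_lt.
have -> : l - h^-1 *: (f (h *: 1 + z) - f z) =
    - h^-1 * (f (z + h) - f z - l * h).
  rewrite [h *: 1]mulr1 [h + z]addrC /GRing.scale /=; field.
  exact: h0.
rewrite normrM normrN normfV ltr_pdivrMl ?normr_gt0//.
apply: (le_lt_trans (fB h hd)).
rewrite expr2 mulrCA ltr_pM2l ?normr_gt0//.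
have BB : B * `|h| <= (`|B| + 1) * `|h|.
  have [->|B0] := eqVneq h 0; first by rewrite normr0 !mulr0.
  have := fB h hd.
  move=> /(le_trans (normr_ge0 _)) Bh.
  have Bge0 : 0 <= B by move: Bh; rewrite pmulr_lge0// exprn_gt0// normr_gt0.
  by rewrite ler_wpM2r// ger0_norm// lerDl.
by rewrite (le_lt_trans BB)// -ltr_pdivlMl// mulrC.
Unshelve. all: by end_near. Qed.

Lemma lim_taylor1 (K : numFieldType) (u1 u2 u3 : nat -> K^o) (h : K) :
  cvgn u1 -> cvgn u2 -> cvgn u3 ->
  (fun n => u1 n - u2 n - u3 n * h) @ \oo -->
    (limn u1 - limn u2 - limn u3 * h : K^o).
Proof.
move=> c1 c2 c3; apply: cvgB; first exact: cvgB.
by apply: cvgM => //; exact: cvg_cst.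
Qed.

Lemma cvgn_geometric (K : numFieldType) (b y : K) : 1 - y != 0 ->
  cvgn (series (fun n => y ^+ n) : nat -> K^o) ->
  limn (series (fun n => b * y ^+ n) : nat -> K^o) = b * (1 - y)^-1.
Proof.
move=> y1 cv; have c0 := cvg_series_cvg_0 cv.
apply: (@cvg_lim K^o (@norm_hausdorff _ _)).
have -> : (series (fun n => b * y ^+ n) : nat -> K^o) =
   fun n => b * (1 - y)^-1 * (1 - y ^+ n).
  apply/funext => n; rewrite /series /= -mulr_sumr big_mkord.
  have -> : 1 - y ^+ n = (1 - y) * \sum_(i < n) y ^+ i.
    by rewrite -opprB subrX1 -mulNr opprB.
  by rewrite -mulrA mulKf.
suff : (fun n => b * (1 - y)^-1 * (1 - y ^+ n) : K^o) @ \oo -->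
    (b * (1 - y)^-1 * (1 - 0) : K^o) by rewrite subr0 mulr1.
by apply: cvgM; [exact: cvg_cst|apply: cvgB => //; exact: cvg_cst].
Qed.

Section ComplexSeries.
Variable R : realType.
Local Notation C := (R[i]^o).
Implicit Types (e v : nat -> C) (z w : C) (q A t : R).

Lemma normC_real t : `|t%:C| = (`|t|)%:C :> R[i].
Proof. by rewrite normc_def /= expr0n addr0 sqrtr_sqr. Qed.

(** Moves a norm, which is a complex number, into the image of R, where the order
is total. *)
Lemma normC_Re z : `|z| = (complex.Re `|z|)%:C.
Proof. by rewrite RRe_real// normr_real. Qed.

Lemma normC_le_ReIm z : `|z| <= (`|complex.Re z| + `|complex.Im z|)%:C.
Proof.
rewrite {1}(complexE z) (le_trans (ler_normD _ _))// rmorphD lerD//=.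
  by rewrite normC_real.
by rewrite normrM normC_real complexiE normCi mul1r.
Qed.

Lemma normC_ge_Im z : (`|complex.Im z|)%:C <= `|z|.
Proof.
rewrite normc_def lecR -[leLHS]sqrtr_sqr ler_wsqrtr// lerDr.
exact: sqr_ge0.
Qed.

Lemma cvgn_ReIm (u : nat -> C) :
  cvgn (fun n => complex.Re (u n)) -> cvgn (fun n => complex.Im (u n)) ->
  cvgn u.
Proof.
move=> /cvg_ex[a ua] /cvg_ex[b ub]; apply/cvg_ex; exists (a +i* b).
apply/cvgrPdist_lt => /= eps eps0.
have [d -> d0] : exists2 d : R, eps = d%:C & 0 < d.
  move: eps0; rewrite ltcE => /andP[/eqP i0 /= r0].
  exists (complex.Re eps) => //; case: eps i0 r0 => x y /= -> _ //.
have d20 : 0 < d / 2 by rewrite divr_gt0.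
move/cvgrPdist_lt : ua => /(_ _ d20) ua.
move/cvgrPdist_lt : ub => /(_ _ d20) ub.
near=> n.
apply: (le_lt_trans (normC_le_ReIm _)); rewrite ltcR [ltRHS]splitr.
have un1 : `|a - complex.Re (u n)| < d / 2 by near: n.
have un2 : `|b - complex.Im (u n)| < d / 2 by near: n.
by case: (u n) un1 un2 => x y /=; exact: ltrD.
Unshelve. all: by end_near. Qed.

(** The real and imaginary parts converge absolutely in R, which is complete. *)
Lemma cvgn_geo e A q : 0 <= q < 1 ->
  (forall n, `|e n| <= (A * q ^+ n)%:C) -> cvgn (series e).
Proof.
move=> /andP[q0 q1] eb.
have geo : cvgn (series (geometric A q)).
  by apply: is_cvg_geometric_series; rewrite ger0_norm.
have part (f : R[i] -> R) : {morph f : x y / x + y} -> f 0 = 0 ->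
    (forall z, (`|f z|)%:C <= `|z|) -> cvgn (fun n => f (series e n)).
  move=> fD f0 fle.
  have -> : (fun n => f (series e n)) = series (f \o e).
    by apply/funext => n; rewrite /series /= (big_morph f fD f0).
  apply: normed_cvg; apply: series_le_cvg geo => n //=.
    have := le_trans (normr_ge0 _) (eb n).
    by rewrite ler0c.
  by rewrite -lecR (le_trans (fle _))// eb.
apply: cvgn_ReIm; apply: part => //.
- by case=> ? ? [? ?].
- exact: normc_ge_Re.
- by case=> ? ? [? ?].
- exact: normC_ge_Im.
Qed.

Lemma limn_norm_le (u : nat -> C) (B : R[i]) :
  cvgn u -> (forall n, `|u n| <= B) -> `|limn u| <= B.
Proof.
move=> cu ub.
have BR : B = (complex.Re B)%:C.
  by rewrite RRe_real// ger0_real// (le_trans _ (ub 0)).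
rewrite BR normC_Re lecR; apply/ler_addgt0Pr => d d0.
move/cvgrPdist_lt : cu => /(_ d%:C); rewrite ltcR => /(_ d0) [N _ /(_ N)] /=.
move=> /(_ (leqnn _)) hN.
rewrite -lecR -normC_Re rmorphD /= -BR addrC.
rewrite -[limn u](subrK (u N)) (le_trans (ler_normD _ _))// lerD//.
exact: ltW.
Qed.

Definition gsum e z : C := limn (series (fun n => e n * z ^+ n) : nat -> C).

Definition geo_bounded e q := exists A, forall n, `|e n| <= (A * q ^+ n)%:C.

Lemma cvgn_gsum e q z : 0 <= q -> `|z| * q%:C < 1 -> geo_bounded e q ->
  cvgn (series (fun n => e n * z ^+ n) : nat -> C).
Proof.
move=> q0 zq [A eb].
apply: (@cvgn_geo _ A (complex.Re `|z| * q)).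
  rewrite mulr_ge0// -?ltcR ?rmorphM /= -?normC_Re//.
  by rewrite -ler0c -normC_Re.
move=> n; rewrite normrM normrX exprMn mulrCA mulrC rmorphM /= rmorphXn /=.
by rewrite -normC_Re ler_wpM2l// exprn_ge0.
Qed.

Lemma gsumD e1 e2 q z : 0 <= q -> `|z| * q%:C < 1 ->
  geo_bounded e1 q -> geo_bounded e2 q ->
  gsum (fun n => e1 n + e2 n) z = gsum e1 z + gsum e2 z.
Proof.
move=> q0 zq b1 b2.
have c1 := cvgn_gsum q0 zq b1; have c2 := cvgn_gsum q0 zq b2.
rewrite /gsum -(lim_seriesD c1 c2).
congr (limn (series _ : nat -> C)); apply/funext => n.
by rewrite /= mulrDl.
Qed.

Lemma gsum_geo (b w : R[i]) z : `|z * w| < 1 ->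
  gsum (fun n => b * w ^+ n) z = b * (1 - z * w)^-1.
Proof.
move=> zw.
have zw1 : 1 - z * w != 0.
  by rewrite subr_eq0; apply/negP => /eqP h; move: zw; rewrite -h normr1 ltxx.
have cv : cvgn (series (fun n => (z * w) ^+ n) : nat -> C).
  apply: (@cvgn_geo _ 1 (complex.Re `|z * w|)).
    by rewrite -ler0c -ltcR -normC_Re normr_ge0.
  by move=> n; rewrite mul1r rmorphXn /= -normC_Re -normrX.
have E : (fun n => b * w ^+ n * z ^+ n) = (fun n => b * (z * w) ^+ n).
  by apply/funext => n; rewrite exprMn mulrAC mulrA.
by rewrite /gsum E (cvgn_geometric b zw1 cv).
Qed.



(** For |h| <= d with (|z| + d) q < 1, the first-order Taylor remainders of the
partial sums are at most |h|^2 times the sum of a geometric series, uniformly in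
the number of terms; this bound survives in the limit. *)
Lemma derivable_gsum e q z : 0 <= q -> `|z| * q%:C < 1 -> geo_bounded e q ->
  derivable (gsum e : C -> C) z 1.
Proof.
move=> q0 zq eb; have [A eA] := eb.
(* Half of the room left by |z| q < 1; q + 1 in place of q avoids dividing by 0. *)
pose d : R[i] := (1 - `|z| * q%:C) / (2 * (q%:C + 1)).
have q10 : 0 < q%:C + 1 :> R[i] by rewrite ltr_wpDl// ler0c.
have d0 : 0 < d by rewrite divr_gt0// ?subr_gt0// mulr_gt0.
have rho0 : 0 <= (`|z| + d) * q%:C by rewrite mulr_ge0 ?ler0c ?addr_ge0// ltW.
have rho1 : (`|z| + d) * q%:C < 1.
  rewrite mulrDl -ltrBrDl /d mulrAC ltr_pdivrMr ?mulr_gt0//.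
  rewrite ltr_pM2l ?subr_gt0//.
  rewrite (@lt_le_trans _ _ (q%:C + 1)) ?ltrDl// ler_peMl//; first exact: ltW.
  by rewrite ler1n.
have A0 : 0 <= A.
  by have := le_trans (normr_ge0 _) (eA 0); rewrite expr0 mulr1 ler0c.
have rhoE : (`|z| + d) * q%:C = (complex.Re ((`|z| + d) * q%:C))%:C.
  by rewrite RRe_real// ger0_real.
set rho := complex.Re _ in rhoE.
have rho01 : 0 <= rho < 1 by rewrite -ler0c -ltcR -rhoE rho0 rho1.
pose e' n : C := e n * (z ^+ n.-1 *+ n).
have ce' : cvgn (series e').
  apply: (@cvgn_geo _ (A / complex.Re d) rho) => // n.
  have dE : d = (complex.Re d)%:C by rewrite RRe_real// gtr0_real.
  rewrite mulrAC !rmorphM /= fmorphV /= -dE rmorphXn /= -rhoE.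
  rewrite ler_pdivlMr// /e' normrM -mulrA.
  rewrite [leRHS](_ : _ = (A * q ^+ n)%:C * (`|z| + d) ^+ n); last first.
    by rewrite exprMn rmorphM rmorphXn /= -mulrA [q%:C ^+ n * _]mulrC.
  apply: ler_pM => //; first by rewrite mulr_ge0// ltW.
  apply: (le_trans _ (expr_tangent_le n (normr_ge0 z) (ltW d0))).
  by rewrite normrMn normrX lerDl exprn_ge0.
pose B := A%:C * (1 - rho%:C)^-1 / d ^+ 2.
apply: (@derivable_taylor1 R[i] _ z (limn (series e' : nat -> C)) d B) => // h hd.
have zhq : `|z + h| * q%:C < 1.
  apply: le_lt_trans rho1; rewrite ler_wpM2r ?ler0c//.
  by rewrite (le_trans (ler_normD _ _))// lerD// ltW.
have c1 := cvgn_gsum q0 zhq eb; have c2 := cvgn_gsum q0 zq eb.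
have cv := lim_taylor1 (h := h) c1 c2 ce'.
rewrite -(cvg_lim (@norm_hausdorff _ _) cv).
apply: limn_norm_le; first by apply/cvg_ex; eexists; exact: cv.
move=> N; rewrite /series /= -sumrB mulr_suml -sumrB.
rewrite (le_trans (ler_norm_sum _ _ _))//.
rewrite /B mulrAC ler_pdivlMr ?exprn_gt0//.
rewrite mulr_suml.
apply: (@le_trans _ _ (\sum_(0 <= n < N) A%:C * `|h| ^+ 2 * rho%:C ^+ n)).
  apply: ler_sum => n _.
  have -> : e n * (z + h) ^+ n - e n * z ^+ n - e' n * h =
      e n * ((z + h) ^+ n - z ^+ n - z ^+ n.-1 *+ n * h).
    by rewrite !mulrBr /e' mulrA.
  rewrite normrM -rhoE.
  rewrite [leRHS](_ : _ = (A * q ^+ n)%:C * (`|h| ^+ 2 * (`|z| + d) ^+ n)).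
    rewrite -mulrA; apply: ler_pM => //; first by rewrite mulr_ge0// exprn_ge0// ltW.
    by rewrite mulrC expr_taylor1_le// ltW.
  by rewrite exprMn rmorphM rmorphXn [in LHS](mulrC (_ ^+ n)) mulrACA.
rewrite -mulr_sumr [leRHS]mulrAC; apply: ler_wpM2l.
  by apply: mulr_ge0; [rewrite ler0c|exact: exprn_ge0].
apply: (@geometric_sum_le R[i]).
by rewrite ler0c -[1]/(1%:C) ltcR.
Qed.

End ComplexSeries.

(** * Functions with at most a simple pole at a point *)

Section SimplePoles.
Variable K : numFieldType.
Implicit Types (f g : K^o -> K^o) (p z B : K^o).

(** B is minus the residue at p, hence B = 0 exactly for a removable singularity. *)
Definition simple_at f p B := exists g,
  (\forall z \near p, derivable g z 1) /\
  (\forall z \near p, f z = B * (p - z)^-1 + g z).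

Lemma derivable_continuous g p : derivable g p 1 -> g @ p --> g p.
Proof. by move=> /derivable1_diffP/differentiable_continuous. Qed.

Lemma derivable_linear_inv (a b z : K) : a - z * b != 0 ->
  derivable (fun y : K^o => (a - y * b)^-1 : K^o) z 1.
Proof.
by move=> ab0; apply: derivableV.
Qed.

Lemma near_linear_neq0 (a b p : K) : a - p * b != 0 ->
  \forall z \near (p : K^o), a - z * b != 0.
Proof.
apply: (@cvgr_neq0 _ K^o _ (nbhs p) _ (fun z : K^o => a - z * b : K^o)).
apply: derivable_continuous; apply: derivableB; first exact: derivable_cst.
by apply: derivableM; [exact: derivable_id|exact: derivable_cst].
Qed.

Lemma near_norm_lt (p r : K) : `|p| < r -> \forall z \near (p : K^o), `|z| < r.
Proof.
exact: (@cvgr_norm_lt K K^o K^o (nbhs (p : K^o)) _ id p (@cvg_id _ _) r).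
Qed.

Lemma simple_at0 f p : simple_at f p 0 -> \forall z \near p, derivable f z 1.
Proof.
move=> [g [dg fg]].
have gf : \forall z \near p, g z = f z.
  by near=> z; rewrite (near fg z)// mul0r add0r.
have {}gf := near_join gf.
by near=> z; apply: (@near_eq_derivable _ _ _ g); near: z.
Unshelve. all: by end_near. Qed.

Lemma simple_at_derivable f p B : simple_at f p B ->
  \forall z \near p^', derivable f z 1.
Proof.
move=> [g [dg fg]].
have gf : \forall z \near p, B * (p - z)^-1 + g z = f z.
  by near=> z; rewrite (near fg z).
have {}gf := nbhs_dnbhs (near_join gf).
have {}dg := nbhs_dnbhs dg.
near=> z; apply: (@near_eq_derivable _ _ _ (fun z => B * (p - z)^-1 + g z)).
  by near: z.
apply: derivableD; last by near: z.
apply: derivableM; first exact: derivable_cst.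
apply: derivableV.
  rewrite subr_eq0 eq_sym; near: z; exact: nbhs_dnbhs_neq.
by apply: derivableB; [exact: derivable_cst|exact: derivable_id].
Unshelve. all: by end_near. Qed.

Lemma simple_at_pole f p B : simple_at f p B -> B != 0 ->
  exists g, [/\ \forall z \near p, derivable g z 1, g p != 0 &
    \forall z \near p^', f z = g z / (z - p) ^+ 1].
Proof.
move=> [g [dg fg]] B0; exists (fun z => - B + (z - p) * g z); split.
- near=> z; apply: derivableD; first exact: derivable_cst.
  apply: derivableM; last by near: z.
  by apply: derivableB; [exact: derivable_id|exact: derivable_cst].
- by rewrite subrr mul0r addr0 oppr_eq0.
- have {}fg := nbhs_dnbhs fg.
  near=> z; have zp : z - p != 0.
    by rewrite subr_eq0; near: z; exact: nbhs_dnbhs_neq.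
  have -> : f z = B * (p - z)^-1 + g z by near: z.
  rewrite expr1 mulrDl mulrAC mulfV// mul1r; congr (_ + _).
  by rewrite -[p - z]opprB invrN mulrN mulNr.
Unshelve. all: by end_near. Qed.

Lemma cvg_dnbhs_eq g1 g2 p : g1 @ p --> g1 p -> g2 @ p --> g2 p ->
  (\forall z \near p^', g1 z = g2 z) -> g1 p = g2 p.
Proof.
move=> c1 c2 g12.
have {}c1 : g1 @ p^' --> g1 p.
  by apply: cvg_trans c1; apply: cvg_app; exact: nbhs_dnbhs.
have {}c2 : g2 @ p^' --> g2 p.
  by apply: cvg_trans c2; apply: cvg_app; exact: nbhs_dnbhs.
apply: (@cvg_unique K^o (@norm_hausdorff _ _) (g1 @ p^')) => //.
apply: cvg_trans c2; apply: near_eq_cvg.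
by near=> z; rewrite (near g12 z).
Unshelve. all: by end_near. Qed.

(** Multiplying both local forms of f by (z - p)^n gives two functions that are
continuous at p and agree around it, so their values at p agree; the right-hand
one vanishes at p as soon as n > 1 or B = 0. *)
Lemma simple_at_order f p B n g : simple_at f p B -> (0 < n)%N ->
  (\forall z \near p, derivable g z 1) -> g p != 0 ->
  (\forall z \near p^', f z = g z / (z - p) ^+ n) -> n = 1%N /\ B != 0.
Proof.
move=> [h [dh fh]] n0 dg gp fg.
have cg := derivable_continuous (nbhs_singleton dg).
pose k z : K^o := (z - p) ^+ n.-1 * (- B + (z - p) * h z).
have ck : k @ p --> k p.
  apply: derivable_continuous; apply: derivableM.
    rewrite (_ : (fun _ => _) = (fun z : K^o => z - p : K^o) ^+ n.-1).
      exact: derivableX.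
    by apply/funext => z; rewrite exprfctE.
  apply: derivableD; first exact: derivable_cst.
  by apply: derivableM => //; exact: nbhs_singleton dh.
have gk : g p = k p.
  apply: cvg_dnbhs_eq => //; have {}fh := nbhs_dnbhs fh.
  near=> z; have zp : z - p != 0.
    by rewrite subr_eq0; near: z; exact: nbhs_dnbhs_neq.
  have : g z / (z - p) ^+ n = B * (p - z)^-1 + h z.
    by rewrite -(near fg z)// (near fh z).
  move=> /(congr1 (fun t => t * (z - p) ^+ n)).
  rewrite divfK ?expf_neq0// => ->; rewrite /k -{1}(prednK n0) exprS.
  rewrite mulrA mulrC mulrDl [X in _ = _ * (_ + X)]mulrC; congr (_ * (_ + _)).
  by rewrite -[p - z]opprB invrN mulrN mulNr divfK.
move: gp; rewrite gk /k subrr mul0r addr0 mulf_eq0 oppr_eq0 negb_or.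
move=> /andP[+ ->]; split => //; case: n n0 {fg k ck gk} a => [//|[//|n] _].
by rewrite exprS mul0r eqxx.
Unshelve. all: by end_near. Qed.

End SimplePoles.

Section Meromorphic.
Variable R : realType.
Local Notation C := (R[i]^o).

Lemma meromorphic_simple (f : C -> C) :
  (forall p : C, exists B : C, simple_at f p B) -> meromorphic f.
Proof.
(* The points where f is not derivable: genuine poles only, without the
   removable singularities, at which no pole order could be given. *)
move=> sf; exists [set p | ~ derivable f p 1]; split.
- rewrite -subset0 => p lp; have [B /simple_at_derivable dfp] := sf p.
  by have [y [yp Sy /(_ yp)]] := lp _ dfp.
- by move=> z /= /contrapT.
- move=> p Sp; exists 1%N; have [B fB] := sf p; split => //.
  apply: (simple_at_pole fB); apply/eqP => B0; apply: Sp.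
  by move: fB; rewrite B0 => /simple_at0/nbhs_singleton.
Qed.

Lemma pole_of_order_simple (f : C -> C) (p B : C) n :
  simple_at f p B -> pole_of_order f n p -> n = 1%N /\ B != 0.
Proof. by move=> fB [n0 [g [dg gp fg]]]; exact: simple_at_order fB n0 dg gp fg. Qed.

End Meromorphic.

(** * Continuation of a generating series with an exponential expansion *)

Section Continuation.
Variable R : realType.
Local Notation C := (R[i]^o).

Lemma geo_boundedW (e : nat -> C) (q q' : R) : 0 <= q <= q' ->
  geo_bounded e q -> geo_bounded e q'.
Proof.
move=> /andP[q0 qq'] [A eA]; exists A => n; apply: (le_trans (eA n)).
have A0 : 0 <= A.
  by have := le_trans (normr_ge0 _) (eA 0); rewrite expr0 mulr1 ler0c.
by rewrite lecR ler_wpM2l// lerXn2r// nnegrE// (le_trans q0).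
Qed.

Lemma geo_boundedD (e1 e2 : nat -> C) (q : R) :
  geo_bounded e1 q -> geo_bounded e2 q ->
  geo_bounded (fun n => e1 n + e2 n) q.
Proof.
move=> [A1 b1] [A2 b2]; exists (A1 + A2) => n.
by rewrite (le_trans (ler_normD _ _))// mulrDl rmorphD lerD.
Qed.

Definition expsum (L : seq (R[i] * R[i])) (n : nat) : R[i] :=
  \sum_(p <- L) p.1 * p.2 ^+ n.

(** The generating series of expsum L, as a rational function. *)
Definition ratsum (L : seq (R[i] * R[i])) (z : R[i]) : R[i] :=
  \sum_(p <- L) p.1 * (1 - z * p.2)^-1.

Lemma expsum_bounded L (q : R) : 0 <= q ->
  (forall p, p \in L -> `|p.2| <= q%:C) -> geo_bounded (expsum L) q.
Proof.
move=> q0; elim: L => [|p L IH] Lq.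
  by exists 0 => n; rewrite /expsum big_nil normr0 mul0r.
have -> : expsum (p :: L) = fun n => p.1 * p.2 ^+ n + expsum L n.
  by apply/funext => n; rewrite /expsum big_cons.
apply: geo_boundedD; last first.
  by apply: IH => p' p'L; apply: Lq; rewrite inE p'L orbT.
exists (complex.Re `|p.1|) => n; rewrite normrM normrX rmorphM rmorphXn /=.
rewrite -normC_Re; apply: ler_wpM2l => //.
apply: lerXn2r; rewrite ?nnegrE//; first by rewrite ler0c.
by apply: Lq; rewrite mem_head.
Qed.

Lemma gsum_expsum L (q : R) (z : C) : 0 <= q -> `|z| * q%:C < 1 ->
  (forall p, p \in L -> `|p.2| <= q%:C) -> gsum (expsum L) z = ratsum L z.
Proof.
move=> q0 zq; elim: L => [|p L IH] Lq.
  have -> : expsum [::] = fun n => 0 * 0 ^+ n.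
    by apply/funext => n; rewrite /expsum big_nil mul0r.
  by rewrite gsum_geo ?mulr0 ?normr0// mul0r /ratsum big_nil.
have -> : expsum (p :: L) = fun n => p.1 * p.2 ^+ n + expsum L n.
  by apply/funext => n; rewrite /expsum big_cons.
have Lq' p' : p' \in L -> `|p'.2| <= q%:C.
  by move=> p'L; apply: Lq; rewrite inE p'L orbT.
have pq : `|p.2| <= q%:C by apply: Lq; rewrite mem_head.
have b1 : geo_bounded (fun n => p.1 * p.2 ^+ n : C) q.
  have -> : (fun n => p.1 * p.2 ^+ n : C) = expsum [:: p].
    by apply/funext => n; rewrite /expsum big_seq1.
  by apply: expsum_bounded => // p'; rewrite inE => /eqP ->.
rewrite (gsumD q0 zq b1 (expsum_bounded q0 Lq')) (IH Lq') gsum_geo.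
  by rewrite /ratsum big_cons.
by rewrite normrM (le_lt_trans _ zq)// ler_wpM2l.
Qed.

(** The terms whose pole is p collect into B / (p - z); the other ones are
holomorphic near p. *)
Lemma ratsum_simple L (p : C) : exists B : C, simple_at (ratsum L : C -> C) p B /\
  (B != 0 -> exists2 w, w \in L & p * w.2 = 1).
Proof.
elim: L => [|w L [B [[g [dg fg]] hB]]].
  exists 0; split; last by rewrite eqxx.
  exists (cst 0); split; near=> z; first exact: derivable_cst.
  by rewrite /ratsum big_nil mul0r addr0.
have [pw|pw] := eqVneq (p * w.2) 1.
  exists (B + w.1 * p); split; last by move=> _; exists w => //; rewrite mem_head.
  exists g; split => //; near=> z.
  rewrite /ratsum big_cons -/(ratsum L z) (near fg z)// addrA; congr (_ + g z).
  have p0 : p != 0.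
    by apply/eqP => p0; move/eqP: pw; rewrite p0 mul0r eq_sym oner_eq0.
  have w2 : w.2 = p^-1 by apply: (mulfI p0); rewrite pw mulfV.
  rewrite mulrDl addrC -!mulrA; congr (_ + _ * _).
  by rewrite -{1}(mulfV p0) w2 -mulrBl invfM invrK mulrC.
exists B; split; last first.
  by move=> /hB[w' w'L pw']; exists w' => //; rewrite inE w'L orbT.
have zw : \forall z \near p, 1 - z * w.2 != 0.
  by apply: near_linear_neq0; rewrite subr_eq0 eq_sym.
exists (fun z => w.1 * (1 - z * w.2)^-1 + g z); split; near=> z.
  apply: derivableD; last by near: z.
  apply: derivableM; first exact: derivable_cst.
  by apply: derivable_linear_inv; near: z.
by rewrite /ratsum big_cons -/(ratsum L z) (near fg z)// addrCA.
Unshelve. all: by end_near. Qed.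

Variables (v : nat -> C) (L : nat -> seq (R[i] * R[i])) (eps : nat -> R).
Hypotheses (eps_gt0 : forall k, 0 < eps k)
  (eps_nincr : forall k, eps k.+1 <= eps k)
  (eps_small : forall d, 0 < d -> exists k, eps k < d)
  (L_le : forall k p, p \in L k -> `|p.2| <= (eps k)%:C).

Let Lcat M := flatten (mkseq L M).

Let remainder M n : C := v n - expsum (Lcat M) n.

Hypothesis remainder_bounded : forall M, geo_bounded (remainder M) (eps M).

Definition partial_continuation M (z : C) : C :=
  ratsum (Lcat M) z + gsum (remainder M) z.

Let eps_le M M' : (M <= M')%N -> eps M' <= eps M.
Proof. by apply: (nonincreasing_seqP eps).1. Qed.

(** From M to M + 1, the exponentials of the block L M leave the remainder series
and enter the rational part.  On the smaller disc both forms make sense and are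
equal, since the corresponding geometric series converge there. *)
Lemma partial_continuation_le M M' z : (M <= M')%N -> `|z| * (eps M)%:C < 1 ->
  partial_continuation M' z = partial_continuation M z.
Proof.
elim: M' => [|M' IH]; first by rewrite leqn0 => /eqP ->.
rewrite leq_eqVlt => /predU1P[-> //|]; rewrite ltnS => MM' zM.
rewrite -(IH MM' zM) /partial_continuation.
have zM' : `|z| * (eps M')%:C < 1.
  by rewrite (le_lt_trans _ zM)// ler_wpM2l// lecR eps_le.
have LcatS : Lcat M'.+1 = Lcat M' ++ L M'.
  by rewrite /Lcat mkseqS flatten_rcons.
have -> : remainder M' = fun n => remainder M'.+1 n + expsum (L M') n.
  apply/funext => n; rewrite /remainder LcatS /expsum big_cat opprD addrA.
  by rewrite subrK.
have e0 := ltW (eps_gt0 M').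
rewrite (gsumD e0 zM' _ (expsum_bounded e0 (@L_le M'))).
  rewrite (gsum_expsum e0 zM' (@L_le M')) LcatS {1}/ratsum big_cat.
  by rewrite -!/(ratsum _ _) -addrA [ratsum (L M') z + _]addrC.
by apply: geo_boundedW (remainder_bounded M'.+1); rewrite ltW ?eps_nincr.
Qed.

(** Any admissible order gives the same value, by partial_continuation_le. *)
Definition continuation (z : C) : C :=
  partial_continuation (xget 0%N [set M | `|z| * (eps M)%:C < 1]) z.

Lemma continuationE M z : `|z| * (eps M)%:C < 1 ->
  continuation z = partial_continuation M z.
Proof.
move=> zM; rewrite /continuation; case: xgetP => [N _ /= zN|/(_ M)//].
by case/orP: (leq_total M N) => MN; [|symmetry]; exact: partial_continuation_le.
Qed.

Lemma continuation_simple (p : C) : exists B : C, simple_at continuation p B /\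
  (B != 0 -> exists k, exists2 w, w \in L k & p * w.2 = 1).
Proof.
have [M pM] : exists M, `|p| * (eps M)%:C < 1.
  have p1 : 0 < complex.Re `|p| + 1 by rewrite ltr_wpDl// -ler0c -normC_Re.
  have [M eM] := eps_small (divr_gt0 ltr01 p1); exists M.
  rewrite normC_Re -rmorphM -[1]/(1%:C) ltcR mulrC.
  move: eM; rewrite ltr_pdivlMr//; apply: le_lt_trans.
  by rewrite ler_wpM2l ?lerDl// ltW.
have zM : \forall z \near p, `|z| * (eps M)%:C < 1.
  have e0 : 0 < (eps M)%:C :> R[i] by rewrite ltcR.
  have {}pM : `|p| < (eps M)%:C^-1 by rewrite -div1r ltr_pdivlMr.
  apply: filterS (@near_norm_lt R[i] _ _ pM) => z.
  by rewrite -div1r ltr_pdivlMr.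
have [B [[g [dg fg]] hB]] := ratsum_simple (Lcat M) p.
exists B; split; last first.
  move=> /hB[w /flattenP[s /mapP[k _ ->] wL pw]].
  by exists k, w.
exists (fun z => g z + gsum (remainder M) z); split; near=> z.
  apply: derivableD; first by near: z.
  apply: (derivable_gsum (ltW (eps_gt0 M))); last exact: remainder_bounded.
  by near: z.
rewrite (@continuationE M); last by near: z.
by rewrite /partial_continuation (near fg z)// addrA.
Unshelve. all: by end_near. Qed.

End Continuation.

(** * Taylor expansion of complex powers *)

Section Taylor.
Variable R : realType.
Implicit Types (s w : R[i]) (t u : R).

Lemma cexpD w1 w2 : cexp (w1 + w2) = cexp w1 * cexp w2 :> R[i].
Proof.
case: w1 w2 => [a b] [c d]; rewrite /cexp /= expRD cosD sinD rmorphM /=.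
by rewrite mulrACA; congr (_ * _); simpc; congr (_ +i* _); ring.
Qed.

Lemma cexp0 : cexp 0 = 1 :> R[i].
Proof. by rewrite /cexp /= expR0 cos0 sin0 mul1r. Qed.

Lemma normC_cexp w : `|cexp w| = (expR (complex.Re w))%:C :> R[i].
Proof.
rewrite /cexp normrM normC_real (ger0_norm (expR_ge0 _)).
by rewrite normc_def /= cos2Dsin2 sqrtr1 mulr1.
Qed.

Lemma rcpowD t w1 w2 : rcpow t (w1 + w2) = rcpow t w1 * rcpow t w2.
Proof. by rewrite /rcpow mulrDl cexpD. Qed.

Lemma rcpow_nat t n : 0 < t -> rcpow t n%:R = t%:C ^+ n.
Proof.
move=> t0; elim: n => [|n IH]; first by rewrite /rcpow mul0r cexp0.
rewrite mulrSr rcpowD IH exprSr; congr (_ * _).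
by rewrite /rcpow mul1r /cexp /= lnK ?posrE// cos0 sin0 mulr1.
Qed.

Lemma rcpowM t u w : 0 < t -> 0 < u -> rcpow (t * u) w = rcpow t w * rcpow u w.
Proof. by move=> t0 u0; rewrite /rcpow lnM ?posrE// rmorphD mulrDr cexpD. Qed.

Lemma rcpowXn t n w : 0 < t -> rcpow (t ^+ n) w = rcpow t w ^+ n.
Proof.
move=> t0; elim: n => [|n IH]; first by rewrite /rcpow ln1 mulr0 cexp0.
by rewrite !exprS rcpowM// ?exprn_gt0// IH.
Qed.

Lemma normC_rcpow t w : 0 < t -> `|rcpow t w| = (t `^ complex.Re w)%:C.
Proof.
move=> t0; rewrite /rcpow normC_cexp /powR gt_eqF//; congr (expR _)%:C.
by case: w => a b /=; rewrite mulr0 subr0.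
Qed.

Lemma rcpow_unit t w : rcpow t (- w) * rcpow t w = 1.
Proof. by rewrite -rcpowD addNr /rcpow mul0r cexp0. Qed.

(** The generalized binomial coefficient, by the recursion that differentiating
(1 + u)^s imposes on Taylor coefficients. *)
Fixpoint gbinom s k : R[i] :=
  if k is k'.+1 then s * gbinom (s - 1) k' / k%:R else 1.

Lemma mvt_power_bound (f df : R -> R) (A d : R) M : f 0 = 0 ->
  (forall t, `|t| <= d -> is_derive t 1 f (df t)) ->
  (forall t, `|t| <= d -> `|df t| <= A * `|t| ^+ M) ->
  forall u, `|u| <= d -> `|f u| <= A * `|u| ^+ M.+1.
Proof.
move=> f0 fdf dfA u ud.
have [->|u0] := eqVneq u 0; first by rewrite f0 normr0 exprS mul0r mulr0.
have A0 : 0 <= A.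
  have := le_trans (normr_ge0 _) (dfA u ud).
  by rewrite pmulr_lge0// exprn_gt0// normr_gt0.
have bound c : `|c| <= `|u| -> f u = df c * u -> `|f u| <= A * `|u| ^+ M.+1.
  move=> cu ->; rewrite normrM exprSr mulrA ler_wpM2r//.
  rewrite (le_trans (dfA c (le_trans cu ud)))// ler_wpM2l//.
  by rewrite lerXn2r// nnegrE.
have cont t : `|t| <= d -> {for t, continuous f}.
  by move=> /fdf dft; apply/differentiable_continuous/derivable1_diffP.
have [ug|ul] := ltP 0 u.
  have [||c /andP[c0 cu]] := @MVT R f df 0 u ug.
  - move=> t; rewrite in_itv /= => /andP[t0 tu]; apply: fdf.
    by rewrite (le_trans _ ud)// !gtr0_norm// ltW.
  - apply: continuous_in_subspaceT => t; rewrite inE /= in_itv /= => /andP[t0 tu].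
    by apply: cont; rewrite (le_trans _ ud)// !ger0_norm// ltW.
  rewrite f0 !subr0 => E; apply: (bound c) => //.
  by rewrite !gtr0_norm// ltW.
have {}ul : u < 0 by rewrite lt_neqAle u0.
have [||c /andP[c0 cu]] := @MVT R f df u 0 ul.
- move=> t; rewrite in_itv /= => /andP[t0 tu]; apply: fdf.
  by rewrite (le_trans _ ud)// !ltr0_norm// lerN2 ltW.
- apply: continuous_in_subspaceT => t; rewrite inE /= in_itv /= => /andP[t0 tu].
  by apply: cont; rewrite (le_trans _ ud)// !ler0_norm// ?lerN2// ltW.
rewrite f0 !sub0r mulrN => /oppr_inj E; apply: (bound c) => //.
by rewrite !ltr0_norm// lerN2 ltW.
Qed.

Lemma rcpowBone t w : 0 < t -> rcpow t (w - 1) = rcpow t w / t%:C.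
Proof.
move=> t0; have t0' : t%:C != 0 :> R[i] by rewrite fmorph_eq0 gt_eqF.
rewrite rcpowD; congr (_ * _); apply: (mulIf t0'); rewrite mulVf//.
by rewrite -[t%:C]expr1 -rcpow_nat// rcpow_unit.
Qed.

Lemma rcpowE t w : rcpow t w =
  (expR (complex.Re w * ln t) * cos (complex.Im w * ln t)) +i*
  (expR (complex.Re w * ln t) * sin (complex.Im w * ln t)).
Proof. by case: w => a b; rewrite /rcpow /cexp /=; simpc. Qed.

Lemma is_derive_rcpow s u : 0 < 1 + u ->
  is_derive u 1 (fun t => complex.Re (rcpow (1 + t) s))
    (complex.Re (s * rcpow (1 + u) (s - 1))) /\
  is_derive u 1 (fun t => complex.Im (rcpow (1 + t) s))
    (complex.Im (s * rcpow (1 + u) (s - 1))).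
Proof.
move=> u0; have dL : is_derive u 1 (fun t => ln (1 + t)) (1 + u)^-1.
  have := is_derive1_ln u0 => dl.
  have d1 : is_derive u 1 (fun t : R => 1 + t) 1.
    by have := is_deriveD (is_derive_cst (1 : R) u 1) (is_derive_id u 1);
      rewrite add0r.
  have := @is_derive1_comp R (@ln R) (fun t => 1 + t) u _ _ dl d1.
  by rewrite mulr1.
have dZ a : is_derive u 1 (fun t => a * ln (1 + t)) (a / (1 + u)).
  exact: (@is_deriveZ _ _ _ (fun t => ln (1 + t)) a u 1 _ dL).
have inv : (1 + u)%:C^-1 = (1 + u)^-1 +i* 0 :> R[i] by rewrite -fmorphV.
rewrite rcpowBone// inv rcpowE; case: s => a b.
have dE := @is_derive1_comp R expR (fun t => a * ln (1 + t)) u _ _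
  (is_derive_expR _) (dZ a).
have dC := @is_derive1_comp R cos (fun t => b * ln (1 + t)) u _ _
  (is_derive_cos _) (dZ b).
have dS := @is_derive1_comp R sin (fun t => b * ln (1 + t)) u _ _
  (is_derive_sin _) (dZ b).
split.
  rewrite [X in is_derive _ _ X](_ : _ =
    (expR \o (fun t => a * ln (1 + t))) * (cos \o (fun t => b * ln (1 + t)))).
    apply: (is_derive_eq (is_deriveM dE dC)).
    by rewrite /GRing.scale /=; simpc => /=; ring.
  by apply/funext => t; rewrite rcpowE.
rewrite [X in is_derive _ _ X](_ : _ =
  (expR \o (fun t => a * ln (1 + t))) * (sin \o (fun t => b * ln (1 + t)))).
  apply: (is_derive_eq (is_deriveM dE dS)).
  by rewrite /GRing.scale /=; simpc => /=; ring.
by apply/funext => t; rewrite rcpowE.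
Qed.

(** Differentiation maps the Taylor polynomial of (1 + u)^s to s times that of
(1 + u)^(s - 1).  The functional f stands for the real or the imaginary part,
for which alone a derivative in the real variable u is taken. *)
Lemma is_derive_gbinom_sum (f : R[i] -> R) s M u :
  {morph f : x y / x + y} -> (forall z t, f (z * t%:C) = f z * t) ->
  is_derive u 1 (fun t => f (\sum_(k < M.+1) gbinom s k * t%:C ^+ k))
    (f (s * \sum_(k < M) gbinom (s - 1) k * u%:C ^+ k)).
Proof.
move=> fD fM; have f0 : f 0 = 0 by have := fM 0 0; rewrite !mulr0.
elim: M => [|M IH].
  rewrite big_ord0 mulr0 f0.
  rewrite [X in is_derive _ _ X](_ : _ = cst (f 1)); first exact: is_derive_cst.
  by apply/funext => t; rewrite big_ord1 expr0 mulr1.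
rewrite [X in is_derive _ _ X](_ : _ =
  (fun t => f (\sum_(k < M.+1) gbinom s k * t%:C ^+ k)) +
  (fun t => f (gbinom s M.+1) * t ^+ M.+1)); last first.
  apply/funext => t; rewrite big_ord_recr /= fD.
  by rewrite -rmorphXn fM.
rewrite big_ord_recr mulrDr fD; apply: is_deriveD.
have dX : is_derive u 1 (fun t : R => t ^+ M.+1) (M.+1%:R * u ^+ M).
  rewrite [X in is_derive _ _ X](_ : _ = (id : R -> R) ^+ M.+1); last first.
    by apply/funext => t; rewrite exprfctE.
  apply: (is_derive_eq (is_deriveX M.+1 (is_derive_id u 1))).
  by rewrite /GRing.scale /= mulr1.
have := @is_deriveZ _ _ _ (fun t : R => t ^+ M.+1) (f (gbinom s M.+1)) u 1 _ dX.
rewrite /GRing.scale /= => /is_derive_eq; apply.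
rewrite -rmorphXn mulrA fM mulrA; congr (_ * _).
rewrite -fM /=; congr f.
by rewrite rmorph_nat divfK// pnatr_eq0.
Qed.

(** Induction on M for all s at once: the remainder of order M + 1 vanishes at 0
and has derivative s times the remainder of order M for s - 1, so the mean value
theorem gains one power of |u|. *)
Lemma rcpow_taylor M s : exists A : R, forall u, `|u| <= 2^-1 ->
  `|rcpow (1 + u) s - \sum_(k < M) gbinom s k * u%:C ^+ k| <=
  (A * `|u| ^+ M)%:C.
Proof.
have pos u : `|u| <= 2^-1 -> 0 < 1 + u.
  by rewrite ler_norml => /andP[+ _]; lra.
elim: M s => [|M IH] s.
  exists (expR (`|complex.Re s| * ln 2)) => u u2.
  rewrite big_ord0 subr0 expr0 mulr1.
  have u0 := pos u u2; rewrite normC_rcpow// lecR /powR gt_eqF// ler_expR.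
  rewrite (le_trans (ler_norm _))// normrM ler_wpM2l// ler_norml.
  move: u2; rewrite ler_norml => /andP[ul ur]; apply/andP; split.
    by rewrite -lnV ?posrE// ler_ln ?posrE ?invr_gt0//; lra.
  by rewrite ler_ln ?posrE//; lra.
have [A hA] := IH (s - 1).
pose F u : R[i] := rcpow (1 + u) s - \sum_(k < M.+1) gbinom s k * u%:C ^+ k.
pose dF u : R[i] :=
  s * (rcpow (1 + u) (s - 1) - \sum_(k < M) gbinom (s - 1) k * u%:C ^+ k).
pose A' := complex.Re `|s| * A.
have dFA u : `|u| <= 2^-1 -> `|dF u| <= (A' * `|u| ^+ M)%:C.
  move=> u2; rewrite normrM -mulrA rmorphM /= -normC_Re ler_wpM2l//.
  exact: hA.
have F0 : F 0 = 0.
  rewrite /F addr0 /rcpow ln1 mulr0 cexp0 big_ord_recl /= expr0 mulr1.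
  rewrite big1 ?addr0 ?subrr// => i _.
  by rewrite exprS mul0r mulr0.
have bound (f : R[i] -> R) : {morph f : x y / x + y} ->
    (forall z t, f (z * t%:C) = f z * t) ->
    (forall z, (`|f z|)%:C <= `|z|) ->
    (forall u, 0 < 1 + u -> is_derive u 1 (fun t => f (rcpow (1 + t) s))
       (f (s * rcpow (1 + u) (s - 1)))) ->
    forall u, `|u| <= 2^-1 -> `|f (F u)| <= A' * `|u| ^+ M.+1.
  move=> fD fM fle df; have f0 : f 0 = 0 by have := fM 0 0; rewrite !mulr0.
  have fB x y : f (x - y) = f x - f y.
    have -> : - y = y * (-1)%:C by rewrite rmorphN1 mulrN1.
    by rewrite fD fM mulrN1.
  apply: (@mvt_power_bound (fun t => f (F t)) (fun t => f (dF t))).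
  - by rewrite F0.
  - move=> t t2; rewrite /F /dF mulrBr fB.
    rewrite [X in is_derive _ _ X](_ : _ = (fun t => f (rcpow (1 + t) s)) -
      (fun t => f (\sum_(k < M.+1) gbinom s k * t%:C ^+ k))).
      apply: is_deriveB; first exact/df/pos.
      exact: is_derive_gbinom_sum.
    by apply/funext => y; rewrite fB.
  - by move=> t t2; rewrite -lecR (le_trans (fle _))// dFA.
exists (A' + A') => u u2; rewrite (le_trans (normC_le_ReIm _))// lecR.
rewrite mulrDl lerD//; apply: bound => //.
- by case=> ? ? [? ?].
- by case=> ? ? ? /=; rewrite mulr0 subr0.
- exact: normc_ge_Re.
- by move=> ? /(is_derive_rcpow s)[].
- by case=> ? ? [? ?].
- by case=> ? ? ? /=; rewrite mulr0 add0r.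
- exact: normC_ge_Im.
- by move=> ? /(is_derive_rcpow s)[].
Qed.

End Taylor.

(** * Exponential form of an irreducible linear recurrence *)

Section Recurrence.

(** Coprimality is decided over the rationals, where p has no proper factor, and
is inherited by any extension field. *)
Lemma irreducible_coprimep (K : numFieldType) (p g : {poly int}) :
  irreducible_poly (map_poly intr p : {poly rat}) ->
  g != 0 -> (size g < size p)%N ->
  coprimep (map_poly intr p : {poly K}) (map_poly intr g).
Proof.
move=> irr g0 gp.
have mapE (q : {poly int}) :
    map_poly intr q = map_poly ratr (map_poly intr q : {poly rat}) :> {poly K}.
  by rewrite -map_poly_comp; apply: eq_map_poly => y /=; rewrite ratr_int.
have sizeQ (q : {poly int}) : size (map_poly intr q : {poly rat}) = size q.
  by apply: size_map_inj_poly => //; exact: intr_inj.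
rewrite !mapE coprimep_map irreducible_poly_coprime//; apply/negP => /dvdp_leq.
rewrite -size_poly_eq0 !sizeQ size_poly_eq0 => /(_ g0).
by rewrite leqNgt gp.
Qed.

Lemma size_sum_leq (T : nzRingType) (I : Type) (s : seq I) (Q : pred I)
    (F : I -> {poly T}) N :
  (forall i, Q i -> (size (F i) <= N)%N) ->
  (size (\sum_(i <- s | Q i) F i)%R <= N)%N.
Proof.
move=> FN; apply: (big_ind (fun q : {poly T} => (size q <= N)%N)) => //.
  by rewrite size_poly0.
by move=> q1 q2 h1 h2; rewrite (leq_trans (size_polyD _ _))// geq_max h1.
Qed.

Variable K : numFieldType.
Implicit Types (p q : {poly K}) (b : nat -> K) (x : K).

(** The value at n of p(shift) applied to the sequence b. *)
Definition act p b n : K := \sum_(i < size p) p`_i * b (n + i)%N.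

Lemma actE N p b n : (size p <= N)%N -> act p b n = \sum_(i < N) p`_i * b (n + i)%N.
Proof.
move=> pN; rewrite /act (big_ord_widen N (fun i => p`_i * b (n + i)%N) pN).
rewrite big_mkcond; apply: eq_bigr => i _; case: ltnP => // pi.
by rewrite nth_default ?mul0r.
Qed.

Lemma act_linear k p q b n : act (k *: p + q) b n = k * act p b n + act q b n.
Proof.
pose N := maxn (size p) (size q).
have sN : (size (k *: p + q)%R <= N)%N.
  rewrite (leq_trans (size_polyD _ _))// geq_max leq_maxr andbT.
  by rewrite (leq_trans (size_scale_leq _ _))// leq_maxl.
rewrite (actE b n sN) (@actE N) ?leq_maxl// (@actE N q) ?leq_maxr//.
rewrite mulr_sumr -big_split; apply: eq_bigr => i _ /=.
by rewrite coefD coefZ mulrDl mulrA.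
Qed.

Lemma act0 b n : act 0 b n = 0. Proof. by rewrite /act size_poly0 big_ord0. Qed.

Lemma actZ k p b n : act (k *: p) b n = k * act p b n.
Proof. by rewrite -[k *: p]addr0 act_linear act0 addr0. Qed.

Lemma act_sum (I : Type) (s : seq I) (F : I -> {poly K}) b n :
  act (\sum_(i <- s) F i) b n = \sum_(i <- s) act (F i) b n.
Proof.
elim: s => [|i s IH]; first by rewrite !big_nil act0.
by rewrite !big_cons -IH -[F i]scale1r act_linear mul1r scale1r.
Qed.

Lemma actXn b n j : act 'X^j b n = b (n + j)%N.
Proof.
rewrite /act size_polyXn big_ord_recr /= coefXn eqxx mul1r big1 ?add0r// => i _.
by rewrite coefXn ltn_eqF ?mul0r.
Qed.

Lemma actMX p b n : act ('X * p) b n = act p b n.+1.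
Proof.
rewrite (@actE (size p).+1); last first.
  by rewrite (leq_trans (size_polyMleq _ _))// size_polyX.
rewrite big_ord_recl coefXM mul0r add0r; apply: eq_bigr => i _.
by rewrite coefXM /= addSnnS.
Qed.

(** The quotient of p by 'X - x when x is a root of p, with explicit
coefficients. *)
Definition root_quotient p x : {poly K} :=
  \sum_(k < size p) p`_k *: \sum_(j < k) x ^+ j *: 'X^(k.-1 - j).

Lemma root_quotientP p x : root p x -> ('X - x%:P) * root_quotient p x = p.
Proof.
move=> /rootP px.
transitivity (\sum_(k < size p) p`_k *: ('X^k - (x ^+ k)%:P)).
  rewrite mulr_sumr; apply: eq_bigr => k _; rewrite -scalerAr; congr (_ *: _).
  rewrite polyC_exp subrXX; congr (_ * _); apply: eq_bigr => j _.
  by rewrite mulrC -polyC_exp mul_polyC.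
under eq_bigr do rewrite scalerBr.
rewrite sumrB -poly_def coefK.
have -> : \sum_(i < size p) p`_i *: (x ^+ i)%:P = p.[x]%:P :> {poly K}.
  rewrite horner_coef rmorph_sum; apply: eq_bigr => i _.
  by rewrite -mul_polyC -polyCM.
by rewrite px polyC0 subr0.
Qed.

Lemma size_root_quotient p x : (size (root_quotient p x) <= (size p).-1)%N.
Proof.
apply: size_sum_leq => k _; rewrite (leq_trans (size_scale_leq _ _))//.
apply: size_sum_leq => j _; rewrite (leq_trans (size_scale_leq _ _))// size_polyXn.
case: k j => [[|k] /= kp] [j //= jk].
by rewrite (leq_trans _ (_ : k.+1 <= _)%N)// ?ltnS ?leq_subr// -ltnS (ltn_predK kp).
Qed.

Lemma act_root_quotient p x b n : act (root_quotient p x) b n =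
  \sum_(k < size p) p`_k * \sum_(j < k) x ^+ j * b (n + (k.-1 - j))%N.
Proof.
rewrite act_sum; apply: eq_bigr => k _; rewrite actZ act_sum; congr (_ * _).
by apply: eq_bigr => j _; rewrite actZ actXn.
Qed.

(** The polynomial part of p(X) (a 1 / X + a 2 / X^2 + ...), of degree less than
that of p and, for p monic, with leading coefficient a 1. *)
Definition initial_numerator (p : {poly int}) (a : nat -> int) : {poly int} :=
  \sum_(k < size p) p`_k *: \sum_(j < k) a (1 + (k.-1 - j))%N *: 'X^j.

Lemma size_initial_numerator (p : {poly int}) (a : nat -> int) : (0 < size p)%N ->
  (size (initial_numerator p a) < size p)%N.
Proof.
move=> p0; rewrite -[ltnRHS](prednK p0) ltnS; apply: size_sum_leq => k _.
rewrite (leq_trans (size_scale_leq _ _))//; apply: size_sum_leq => j _.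
rewrite (leq_trans (size_scale_leq _ _))// size_polyXn (leq_trans (ltn_ord j))//.
by rewrite -ltnS prednK.
Qed.

Lemma initial_numerator_neq0 (p : {poly int}) (a : nat -> int) r :
  size p = r.+2 -> p \is monic -> a 1%N != 0 -> initial_numerator p a != 0.
Proof.
move=> sp /monicP; rewrite /lead_coef sp /= => pr a1.
suff : (initial_numerator p a)`_r = a 1%N.
  by apply: contra_eq_neq => ->; rewrite coef0 eq_sym.
rewrite /initial_numerator coef_sum sp big_ord_recr /= pr scale1r.
rewrite big1 ?add0r; last first.
  move=> k _; rewrite coefZ coef_sum big1 ?mulr0// => j _.
  rewrite coefZ coefXn gtn_eqF ?mulr0//.
  by rewrite (leq_trans (ltn_ord j))// -ltnS.
rewrite coef_sum big_ord_recr /= coefZ coefXn eqxx mulr1 subnn.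
rewrite big1 ?add0r// => j _.
by rewrite coefZ coefXn gtn_eqF ?mulr0.
Qed.

(** For a root x of p, the left-hand side is, up to a nonzero factor, the
coefficient of x^n in the sequence a; it is thus the value at x of a polynomial
with integer coefficients, to which the irreducibility of p applies. *)
Lemma act_root_quotient_init (p : {poly int}) (a : nat -> int) x :
  act (root_quotient (map_poly intr p) x) (fun n => (a n)%:~R) 1 =
  (map_poly intr (initial_numerator p a) : {poly K}).[x].
Proof.
rewrite act_root_quotient /initial_numerator rmorph_sum horner_sum.
have -> : size (map_poly intr p : {poly K}) = size p.
  by apply: size_map_inj_poly => //; exact: intr_inj.
apply: eq_bigr => k _; rewrite coef_map /= map_polyZ hornerZ; congr (_ * _).
rewrite rmorph_sum horner_sum; apply: eq_bigr => j _.
by rewrite /= map_polyZ hornerZ map_polyXn hornerXn mulrC.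
Qed.

(** Lagrange interpolation of the constant 1 at the roots of p. *)
Lemma Lagrange_root_quotient p (rs : seq K) :
  (0 < size rs)%N -> uniq rs -> size p = (size rs).+1 -> all (root p) rs ->
  (forall x, x \in rs -> p^`().[x] != 0) ->
  \sum_(x <- rs) (p^`().[x])^-1 *: root_quotient p x = 1.
Proof.
move=> s0 us sp /allP rp dp; apply/eqP; rewrite -subr_eq0; apply/eqP.
have rq x : x \in rs -> (root_quotient p x).[x] = p^`().[x].
  move=> sx; rewrite -{2}(root_quotientP (rp x sx)) derivM hornerD !hornerM.
  by rewrite derivB derivX derivC subr0 !hornerE subrr mul0r addr0.
apply: (@roots_geq_poly_eq0 _ _ rs) => //; last first.
  rewrite (leq_trans (size_polyD _ _))// size_polyN size_poly1 geq_max s0 andbT.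
  apply: size_sum_leq => x _; rewrite (leq_trans (size_scale_leq _ _))//.
  by rewrite (leq_trans (size_root_quotient _ _))// sp.
apply/allP => y sy; apply/rootP.
rewrite hornerD hornerN hornerC horner_sum (bigD1_seq y)//=.
rewrite hornerZ rq// mulVf ?dp// big_seq_cond big1 ?addr0 ?subrr//.
move=> x /andP[sx xy]; rewrite hornerZ.
have : (y - x) * (root_quotient p x).[y] = 0.
  have /rootP := rp y sy; rewrite -{1}(root_quotientP (rp x sx)).
  by rewrite hornerM !hornerE.
move/eqP; rewrite mulf_eq0 subr_eq0 eq_sym (negbTE xy) /= => /eqP ->.
by rewrite mulr0.
Qed.

(** Applying the Lagrange identity to the shift operator writes a as the sum of the
sequences (p / (X - x))(shift) a, divided by p'(x).  Each of them is annihilated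
by shift - x, hence geometric of ratio x. *)
Lemma exponential_form (p : {poly int}) (a : nat -> int) (rs : seq K) :
  irreducible_poly (map_poly intr p : {poly rat}) -> p \is monic ->
  map_poly intr p = \prod_(x <- rs) ('X - x%:P) ->
  (forall x, x \in rs -> x != 0) ->
  annihilates p a -> a 1%N != 0 ->
  uniq rs /\ exists c : K -> K, (forall x, x \in rs -> c x != 0) /\
    forall n, (0 < n)%N -> (a n)%:~R = \sum_(x <- rs) c x * x ^+ n.
Proof.
move=> irr mp pE rs0 pa a1; pose pC : {poly K} := map_poly intr p.
have spC : size pC = (size rs).+1 by rewrite /pC pE size_prod_XsubC.
have sp : size p = (size rs).+1.
  by rewrite -spC; symmetry; apply: size_map_inj_poly => //; exact: intr_inj.
have rs_gt0 : (0 < size rs)%N.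
  case: irr => + _; rewrite size_map_inj_poly //; last exact: intr_inj.
  by rewrite sp ltnS.
have rp : all (root pC) rs.
  by apply/allP => x xs; rewrite /pC pE root_prod_XsubC.
have p'0 : p^`() != 0.
  apply/eqP => /(congr1 (fun q : {poly int} => q`_(size rs).-1)).
  rewrite coef_deriv coef0 prednK//; move/monicP: mp; rewrite /lead_coef sp /=.
  by move=> -> /eqP; rewrite mulrn_eq0 oner_eq0 orbF gtn_eqF.
(* In characteristic 0 irreducible polynomials are separable. *)
have sep : coprimep pC pC^`().
  rewrite /pC deriv_map; apply: irreducible_coprimep => //.
  by rewrite lt_size_deriv// -size_poly_eq0 sp.
have dp x : x \in rs -> pC^`().[x] != 0.
  by move=> xs; apply: (coprimep_root sep); exact: (allP rp).
have us : uniq rs by rewrite -separable_prod_XsubC -pE unlock.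
split=> //.
have rec x n : x \in rs -> (0 < n)%N ->
    act (root_quotient pC x) (fun n => (a n)%:~R) n.+1 =
    x * act (root_quotient pC x) (fun n => (a n)%:~R) n.
  move=> xs n0; apply/eqP; rewrite -subr_eq0; apply/eqP.
  rewrite -actMX -mulNr addrC -act_linear.
  rewrite (_ : _ + _ = pC); last first.
    by rewrite -[RHS](root_quotientP (allP rp _ xs)) mulrBl mul_polyC scaleNr addrC.
  rewrite (@actE (size p)); last by rewrite spC sp.
  have := pa n n0 => /(congr1 (fun z : int => z%:~R : K)).
  rewrite rmorph_sum /= => E; apply: etrans E; apply: eq_bigr => i _.
  by rewrite coef_map rmorphM.
have expo x n : x \in rs ->
    act (root_quotient pC x) (fun n => (a n)%:~R) n.+1 =
    x ^+ n * act (root_quotient pC x) (fun n => (a n)%:~R) 1.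
  move=> xs; elim: n => [|n IH]; first by rewrite mul1r.
  by rewrite rec// IH exprS mulrA.
(* The division by x accounts for indexing from 1: the geometric sequence of
   ratio x is known by its value at 1. *)
exists (fun x => (pC^`().[x])^-1 *
   act (root_quotient pC x) (fun n => (a n)%:~R) 1 / x); split.
  move=> x xs; apply: mulf_neq0; last by rewrite invr_eq0 rs0.
  apply: mulf_neq0; first by rewrite invr_eq0 dp.
  rewrite act_root_quotient_init.
  suff cop : coprimep pC (map_poly intr (initial_numerator p a)).
    exact: coprimep_root cop (allP rp _ xs).
  apply: irreducible_coprimep => //.
    apply: (@initial_numerator_neq0 _ _ (size rs).-1) => //.
    by rewrite sp prednK.
  by apply: size_initial_numerator; rewrite sp.
case=> [//|n] _.
transitivity (act 1 (fun n => (a n)%:~R) n.+1 : K).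
  by rewrite -(expr0 'X) actXn addn0.
rewrite -(Lagrange_root_quotient rs_gt0 us spC rp dp) act_sum.
rewrite big_seq [RHS]big_seq; apply: eq_bigr => x xs; rewrite actZ expo//.
rewrite exprS -!mulrA; congr (_ * _).
by rewrite [x^-1 * _]mulrA mulVf ?rs0// mul1r mulrC.
Qed.

End Recurrence.

(** * Expansion of the shifted complex powers *)

Section ExponentialSums.
Variable R : realType.
Local Notation C := (R[i]^o).
Implicit Types (L U : seq (R[i] * R[i])) (q : R).

Lemma geo_bounded_eventually (e : nat -> C) q N : 0 < q ->
  (exists A : R, forall n, (N <= n)%N -> `|e n| <= (A * q ^+ n)%:C) ->
  geo_bounded e q.
Proof.
move=> q0; elim: N => [[A hA]|N IH [A hA]]; first by exists A => n; exact: hA.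
apply: IH; exists (Num.max A (complex.Re `|e N| / q ^+ N)) => n.
have qn m : 0 < q ^+ m by rewrite exprn_gt0.
rewrite leq_eqVlt => /predU1P[<-|/hA].
  by rewrite normC_Re lecR -ler_pdivrMr// le_max lexx orbT.
by move=> /le_trans; apply; rewrite lecR ler_pM2r// le_max lexx.
Qed.

Lemma expsum_flatten (L : nat -> seq (R[i] * R[i])) M n :
  expsum (flatten (mkseq L M)) n = \sum_(k < M) expsum (L k) n.
Proof.
elim: M => [|M IH]; first by rewrite big_ord0 /expsum big_nil.
rewrite mkseqS flatten_rcons big_ord_recr /= -IH.
by rewrite {1}/expsum big_cat.
Qed.

Definition expmul L U := [seq (p.1 * t.1, p.2 * t.2) | p <- L, t <- U].

Lemma expsum_mul L U n : expsum (expmul L U) n = expsum L n * expsum U n.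
Proof.
rewrite /expsum big_allpairs_dep big_distrl; apply: eq_bigr => p _ /=.
rewrite big_distrr; apply: eq_bigr => t _ /=.
by rewrite exprMn mulrACA.
Qed.

Definition exppow U k := iter k (expmul U) [:: (1, 1)].

Lemma expsum_pow U k n : expsum (exppow U k) n = expsum U n ^+ k.
Proof.
elim: k => [|k IH]; first by rewrite /expsum big_seq1 expr1n mulr1.
by rewrite [exppow _ _]/= expsum_mul IH exprS.
Qed.

Lemma exppow_ind U (Q : nat -> R[i] -> Prop) : Q 0%N 1 ->
  (forall k p w, p \in U -> Q k w -> Q k.+1 (p.2 * w)) ->
  forall k p, p \in exppow U k -> Q k p.2.
Proof.
move=> Q1 QS; elim=> [p|k IH p]; first by rewrite inE => /eqP ->.
move=> /allpairsP[[t w] /= [tU wU ->]] /=; apply: QS => //; exact: IH.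
Qed.

Lemma exists_ratio L : (forall p, p \in L -> `|p.2| < 1) ->
  exists2 th : R, 0 < th < 1 & forall p, p \in L -> `|p.2| <= th%:C.
Proof.
elim: L => [|p L IH] hL.
  by exists 2^-1 => //; rewrite invr_gt0 invf_lt1// ltr0n ltr1n.
have [|th /andP[t0 t1] ht] := IH.
  by move=> t tL; apply: hL; rewrite inE tL orbT.
have p1 : complex.Re `|p.2| < 1 by rewrite -ltcR -normC_Re hL// mem_head.
exists (Num.max th (complex.Re `|p.2|)); first by rewrite lt_max t0 gt_max t1 p1.
move=> t; rewrite inE => /predU1P[->|/ht /le_trans]; last first.
  by apply; rewrite lecR le_max lexx.
by rewrite normC_Re lecR le_max lexx orbT.
Qed.

Lemma geometric_le0 (y A th : R) : 0 < th < 1 ->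
  (forall n, (0 < n)%N -> y <= A * th ^+ n) -> y <= 0.
Proof.
move=> /andP[t0 t1] yA; rewrite leNgt; apply/negP => y0.
have := @cvg_geometric R A th; rewrite gtr0_norm// => /(_ t1).
move=> /(@cvgr0_norm_lt _ R^o) /(_ _ y0) [N _ /(_ N.+1 (leqnSn _))] /=.
by move=> /(le_lt_trans (ler_norm _)); rewrite ltNge yA.
Qed.

End ExponentialSums.

Section Expansion.
Variable R : realType.
Local Notation C := (R[i]^o).
Variables (a : nat -> int) (c1 alpha1 th x : R) (U : seq (R[i] * R[i])) (s : R[i]).
Hypotheses (c1_gt0 : 0 < c1) (alpha1_gt0 : 0 < alpha1) (th_itv : 0 < th < 1)
  (U_le : forall p, p \in U -> `|p.2| <= th%:C)
  (aU : forall n, (1 <= n)%N ->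
    ((a n)%:~R + x)%:C = (c1 * alpha1 ^+ n)%:C * (1 + expsum U n)).

(** The junk value at 0 makes phi a plain power series starting at degree 0; it is
absorbed by the constants of the geometric bounds. *)
Definition shifted_power n : C :=
  if n is 0 then 0 else rcpow ((a n)%:~R + x) (- s).

(** The k-th Taylor term of (a n + x)^(-s), as an exponential sum. *)
Definition block k : seq (R[i] * R[i]) :=
  [seq (rcpow c1 (- s) * gbinom (- s) k * p.1, rcpow alpha1 (- s) * p.2)
     | p <- exppow U k].

Definition block_ratio k := alpha1 `^ (- complex.Re s) * th ^+ k.

Lemma expsum_block k n : expsum (block k) n =
  rcpow c1 (- s) * rcpow alpha1 (- s) ^+ n * (gbinom (- s) k * expsum U n ^+ k).
Proof.
rewrite -expsum_pow /expsum big_map !mulr_sumr; apply: eq_bigr => p _ /=.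
by rewrite exprMn mulrACA [RHS]mulrA; congr (_ * _); rewrite mulrAC.
Qed.

Lemma normC_rcpowN t : 0 < t -> `|rcpow t (- s)| = (t `^ (- complex.Re s))%:C.
Proof. by move=> t0; rewrite normC_rcpow//; case: s. Qed.

Lemma block_ratio_gt0 k : 0 < block_ratio k.
Proof. by case/andP: th_itv => t0 _; rewrite mulr_gt0 ?powR_gt0 ?exprn_gt0. Qed.

Lemma block_ratio_nincr k : block_ratio k.+1 <= block_ratio k.
Proof.
case/andP: th_itv => t0 t1; rewrite ler_pM2l ?powR_gt0// exprS ger_pMl ?exprn_gt0//.
exact: ltW.
Qed.

Lemma block_ratio_small d : 0 < d -> exists k, block_ratio k < d.
Proof.
move=> d0; apply: contrapT => nk.
have : d <= 0; last by rewrite leNgt d0.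
apply: (@geometric_le0 _ _ (alpha1 `^ (- complex.Re s)) _ th_itv) => n _.
by rewrite leNgt; apply/negP => h; apply: nk; exists n.
Qed.

Lemma block_le k p : p \in block k -> `|p.2| <= (block_ratio k)%:C.
Proof.
move=> /mapP[w wU ->] /=.
rewrite normrM normC_rcpowN// rmorphM ler_wpM2l ?ler0c ?powR_ge0//.
move: k w wU; apply: (@exppow_ind _ U (fun k w => `|w| <= (th ^+ k)%:C)).
  by rewrite normr1 expr0.
move=> k w y wU yk; rewrite normrM exprS rmorphM; apply: ler_pM => //.
exact: U_le.
Qed.

(** With (a n + x)^(-s) = c1^(-s) alpha1^(-s n) (1 + u n)^(-s) and u n = O(th^n),
this is the Taylor remainder of order M, as soon as n is large enough for
|u n| <= 1/2. *)
Lemma block_remainder M :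
  geo_bounded (fun n => shifted_power n - expsum (flatten (mkseq block M)) n)
    (block_ratio M).
Proof.
have [t0 t1] := andP th_itv.
have [B hB] := expsum_bounded (ltW t0) U_le.
have [A hA] := rcpow_taylor M (- s).
pose u n : R := complex.Re (expsum U n).
have uE n : (1 <= n)%N -> expsum U n = (u n)%:C.
  move=> n1; have c0 : (c1 * alpha1 ^+ n)%:C != 0 :> R[i].
    by rewrite fmorph_eq0 gt_eqF// mulr_gt0 ?exprn_gt0.
  have : 1 + expsum U n = (((a n)%:~R + x) / (c1 * alpha1 ^+ n))%:C.
    by rewrite fmorph_div /= aU// mulrC mulKf.
  set y := (_ / _) => /(congr1 (fun t => t - 1)); rewrite addrC addKr => E.
  have {}E : expsum U n = (y - 1)%:C by rewrite E rmorphB rmorph1.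
  by rewrite /u E.
have uB n : (1 <= n)%N -> `|u n| <= B * th ^+ n.
  by move=> n1; rewrite -lecR -normC_real -uE.
have [N hN] : exists N, forall n, (N <= n)%N -> B * th ^+ n <= 2^-1.
  have := @cvg_geometric R B th; rewrite gtr0_norm// => /(_ t1).
  move=> /(@cvgr0_norm_lt _ R^o) /(_ 2^-1) []; first by rewrite invr_gt0.
  move=> N _ hN; exists N => n Nn; apply/ltW/(le_lt_trans (ler_norm _)).
  exact: hN.
apply: (@geo_bounded_eventually _ _ _ N.+1); first exact: block_ratio_gt0.
exists (complex.Re `|rcpow c1 (- s)| * (`|A| * B ^+ M)) => n Nn.
have n1 : (1 <= n)%N by apply: leq_trans Nn.
have u2 : `|u n| <= 2^-1 by rewrite (le_trans (uB n n1))// hN// ltnW.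
have u1 : 0 < 1 + u n by move: u2; rewrite ler_norml => /andP[+ _]; lra.
have vE : shifted_power n = rcpow c1 (- s) * rcpow alpha1 (- s) ^+ n *
    rcpow (1 + u n) (- s).
  rewrite /shifted_power; case: n n1 {Nn u2} uE u1 => // n _ uE u1.
  have an0 : 0 < alpha1 ^+ n.+1 by rewrite exprn_gt0.
  rewrite -rcpowXn// -(rcpowM _ c1_gt0 an0) -(rcpowM _ (mulr_gt0 c1_gt0 an0) u1).
  have E : ((a n.+1)%:~R + x)%:C = (c1 * alpha1 ^+ n.+1 * (1 + u n.+1))%:C.
    by rewrite aU// uE// [RHS]rmorphM [X in _ = _ * X]rmorphD rmorph1.
  have -> : (a n.+1)%:~R + x = c1 * alpha1 ^+ n.+1 * (1 + u n.+1).
    exact: (congr1 (@complex.Re R) E).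
  by [].
rewrite expsum_flatten vE; under eq_bigr do rewrite expsum_block uE//.
rewrite -mulr_sumr -mulrBr (normrM (_ * rcpow alpha1 _ ^+ n)).
rewrite (normrM (rcpow c1 _)) normrX (normC_rcpowN alpha1_gt0).
rewrite /block_ratio exprMn mulrACA rmorphM; apply: ler_pM => //.
- by apply: mulr_ge0 => //; rewrite exprn_ge0// ler0c powR_ge0.
- by rewrite [X in X * _ <= _]normC_Re -rmorphXn -rmorphM.
apply: (le_trans (hA _ u2)); rewrite lecR -exprM mulnC exprM -mulrA -exprMn.
rewrite (@le_trans _ _ (`|A| * `|u n| ^+ M))//.
  by rewrite ler_wpM2r ?exprn_ge0// ler_norm.
rewrite ler_wpM2l// lerXn2r ?nnegrE//; last exact: uB.
exact: le_trans (normr_ge0 _) (uB n n1).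
Qed.

Lemma phi_psumE z : phi_psum a s x z =
  (series (fun n => shifted_power n * z ^+ n) : nat -> C).
Proof.
apply/funext => -[|N]; rewrite /phi_psum /series /=.
  by rewrite !big_geq.
rewrite [RHS]big_ltn// mul0r add0r !big_nat; apply: eq_bigr => n /andP[n0 _].
by rewrite /phi_term mulrC; case: n n0.
Qed.

(** The analytic part of the final theorem, for any sequence of the form
c1 alpha1^n (1 + exponentials of ratio < 1). *)
Theorem meromorphic_continuation :
  let D := [set z : C | `|z| < (alpha1 `^ complex.Re s)%:C] in
  [/\ (forall z, D z -> cvgn (phi_psum a s x z)),
      holomorphic_on D (phi a s x) &
      exists Phi : C -> C,
        [/\ meromorphic Phi,
            (forall z, D z -> Phi z = phi a s x z) &
            forall (p : C) (n : nat), pole_of_order Phi n p ->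
              n = 1%N /\
              exists k, exists2 w, w \in exppow U k &
                p = (rcpow alpha1 (- s) * w.2)^-1]].
Proof.
move=> D.
have DE z : D z -> `|z| * (block_ratio 0)%:C < 1.
  move=> zD; rewrite /block_ratio expr0 mulr1 powRN fmorphV ltr_pdivrMr ?mul1r//.
  by rewrite ltcR powR_gt0.
have bv : geo_bounded shifted_power (block_ratio 0).
  have := block_remainder 0.
  by congr (geo_bounded _ _); apply/funext => n; rewrite /expsum big_nil subr0.
have r0 := ltW (block_ratio_gt0 0).
have phiE : phi a s x = gsum shifted_power.
  by apply/funext => z; rewrite /phi phi_psumE.
pose Phi := continuation shifted_power block block_ratio.
have simple := continuation_simple block_ratio_gt0 block_ratio_nincr
  block_ratio_small block_le block_remainder.
split.
- by move=> z /DE zD; rewrite phi_psumE; exact: cvgn_gsum bv.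
- by rewrite phiE => z /DE zD; exact: derivable_gsum bv.
exists Phi; split.
- by apply: meromorphic_simple => p; have [B [? _]] := simple p; exists B.
- move=> z /DE zD; rewrite phiE /Phi.
  rewrite (continuationE block_ratio_gt0 block_ratio_nincr block_le
    block_remainder zD).
  rewrite /partial_continuation /ratsum big_nil add0r; congr (gsum _ z).
  by apply/funext => n; rewrite /expsum big_nil subr0.
- move=> p n pn; have [B [sB hB]] := simple p.
  have [-> /hB[k [w' /mapP[w wU ->]]]] := pole_of_order_simple sB pn.
  move=> /= pw; split=> //; exists k, w => //.
  have w0 : rcpow alpha1 (- s) * w.2 != 0.
    by apply/eqP => w0; move/eqP: pw; rewrite w0 mulr0 eq_sym oner_eq0.
  by apply: (mulIf w0); rewrite pw mulVf.
Qed.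

End Expansion.

(** * Location of the poles *)

Section Poles.
Variable R : realType.

(** c is a limit of nonnegative real numbers. *)
Lemma dominant_coef_gt0 (c : R[i]) (e : nat -> R[i]^o) (th : R) : c != 0 ->
  0 < th < 1 -> geo_bounded e th -> (forall n, (0 < n)%N -> 0 <= c + e n) ->
  0 < c.
Proof.
move=> c0 th01 [A eA] ce; rewrite lt_def c0 lecE /=.
apply/andP; split.
  rewrite -normr_le0; apply: (geometric_le0 (A := A) th01) => n n0.
  rewrite -lecR (le_trans _ (eA n))// (le_trans _ (normC_ge_Im _))// lecR.
  have := ce n n0; rewrite lecE => /andP[+ _].
  case: c (e n) {c0 ce} => [a b] [a' b'] /=.
  by rewrite addr_eq0 => /eqP ->; rewrite normrN.
rewrite -oppr_le0; apply: (geometric_le0 (A := A) th01) => n n0.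
rewrite -lecR (le_trans _ (eA n))// (le_trans _ (normc_ge_Re _))// lecR.
have := ce n n0; rewrite lecE => /andP[_].
case: c (e n) {c0 ce} => [a b] [a' b'] /= h.
by rewrite (le_trans _ (ler_norm _))// -subr_ge0 opprK addrC.
Qed.

Lemma prod_expr_delta (r i : nat) (y : nat -> R[i]) : (2 <= i < r.+1)%N ->
  \prod_(2 <= l < r.+1) y l ^+ (l == i) = y i.
Proof.
move=> ir; rewrite (bigD1_seq i) ?mem_index_iota ?iota_uniq//= eqxx expr1.
by rewrite big1 ?mulr1// => l /negbTE ->.
Qed.

Lemma monomial_exppow (U : seq (R[i] * R[i])) (b : R[i]) (r : nat)
    (y : nat -> R[i]) :
  (forall p, p \in U -> p.2 = b \/ exists2 i, (2 <= i < r.+1)%N & p.2 = y i) ->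
  forall k p, p \in exppow U k -> exists j m,
    p.2 = b ^+ j * \prod_(2 <= i < r.+1) y i ^+ (m i).
Proof.
move=> hU; apply: (@exppow_ind _ U (fun _ w => exists j m,
  w = b ^+ j * \prod_(2 <= i < r.+1) y i ^+ (m i))) => [|_ p w pU [j [m ->]]].
  by exists 0%N, (fun=> 0%N); rewrite big1 ?mulr1.
case: (hU p pU) => [->|[i ir ->]].
  by exists j.+1, m; rewrite exprS mulrA.
exists j, (fun l => m l + (l == i))%N.
have -> : \prod_(2 <= l < r.+1) y l ^+ (m l + (l == i)) =
    (\prod_(2 <= l < r.+1) y l ^+ m l) * y i.
  under eq_bigr do rewrite exprD.
  by rewrite big_split /= prod_expr_delta.
by rewrite [RHS]mulrA [RHS]mulrC.
Qed.

(** The multiplicities m i of the ratios alpha i / alpha1 are the successive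
differences k (i - 1) - k i of the indices of the pole. *)
Lemma pole_pointE (r : nat) (alpha1 : R) (alpha : nat -> R[i]) (s : R[i])
    (j : nat) (m : nat -> nat) : 0 < alpha1 ->
  exists k, pole_index r k /\
    (rcpow alpha1 (- s) * ((alpha1^-1)%:C ^+ j *
       \prod_(2 <= i < r.+1) (alpha i / alpha1%:C) ^+ m i))^-1 =
    pole_point r alpha1 alpha s j k.
Proof.
move=> al0; pose k i := (\sum_(i.+1 <= l < r.+1) m l)%N.
have kS i : (i < r)%N -> k i = (m i.+1 + k i.+1)%N.
  by move=> ir; rewrite /k big_ltn.
exists k; split.
  split; first by rewrite /k big_geq.
  by move=> i /andP[_ ir]; rewrite (kS i)// leq_addl.
have al0' : alpha1%:C != 0 :> R[i] by rewrite fmorph_eq0 gt_eqF.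
have rho_inv : (rcpow alpha1 (- s))^-1 = rcpow alpha1 s.
  have rho0 : rcpow alpha1 (- s) != 0.
    apply/eqP => h; have := @rcpow_unit _ alpha1 s.
    by rewrite h mul0r => /esym/eqP; rewrite oner_eq0.
  by apply: (mulfI rho0); rewrite mulfV// rcpow_unit.
rewrite /pole_point !rcpowD !rcpow_nat// (invfM (rcpow _ _)) rho_inv.
move: (rcpow alpha1 s) => rho; rewrite invfM -!mulrA.
congr (_ * (_ * _)); first by rewrite fmorphV exprVn invrK.
rewrite -prodfV /k -prodrXr -big_split /= !big_nat.
apply: eq_bigr => i /andP[i2 ir].
have i1r : (i.-1 < r)%N by case: i i2 ir => // i _; rewrite ltnS.
have E : (k i)%:Z - (k i.-1)%:Z = - (m i)%:Z.
  by rewrite (kS _ i1r) (ltn_predK i2) PoszD opprD addrCA subrr addr0.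
by rewrite E -exprnN exprMn invfM exprVn invrK mulrC.
Qed.

End Poles.

Theorem theorem6p1 (R : realType) (a : nat -> int) (P : {poly int}) (r : nat)
    (alpha : nat -> R[i]) (alpha1 : R)
    (min_P : is_min_rec_poly P a)
    (irr_P : irreducible_poly (map_poly intr P : {poly rat}))
    (deg_P : size P = r.+1)
    (roots_P : map_poly intr P =
               \prod_(1 <= i < r.+1) ('X - (alpha i)%:P) :> {poly R[i]})
    (alpha1E : alpha 1%N = alpha1%:C) (alpha1_gt1 : 1 < alpha1)
    (dominant : forall i, (2 <= i <= r)%N -> `|alpha i| < alpha1%:C)
    (a_gt0 : forall n, (1 <= n)%N -> 0 < a n)
    (a_incr : forall n, (1 <= n)%N -> a n < a n.+1)
    (s : R[i]) (x : R) (x_ge0 : 0 <= x) (x_lt1 : x < 1) :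
  let D := [set z : R[i]^o | `|z| < (alpha1 `^ complex.Re s)%:C] in
  [/\ (forall z, D z -> cvgn (phi_psum a s x z)),
      holomorphic_on D (phi a s x) &
      exists Phi : R[i]^o -> R[i]^o,
        [/\ meromorphic Phi,
            (forall z, D z -> Phi z = phi a s x z) &
            forall (p : R[i]^o) (n : nat), pole_of_order Phi n p ->
              n = 1%N /\
              exists (j : nat) (k : nat -> nat),
                pole_index r k /\ p = pole_point r alpha1 alpha s j k]].
Proof.
have al0 : 0 < alpha1 by rewrite (lt_trans _ alpha1_gt1).
have al0' : alpha1%:C != 0 :> R[i] by rewrite fmorph_eq0 gt_eqF.
have [mP annP _] := min_P.
have r0 : (0 < r)%N.
  case: irr_P => + _; rewrite size_map_inj_poly //; last exact: intr_inj.
  by rewrite deg_P ltnS.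
pose rs := map alpha (index_iota 1 r.+1).
have rsP : map_poly intr P = \prod_(y <- rs) ('X - y%:P) :> {poly R[i]}.
  by rewrite roots_P big_map.
(* If 0 were a root, P would be linear with 0, not alpha1, as its only root. *)
have rs0 y : y \in rs -> y != 0.
  move=> yrs; have [r1|r1] := leqP r 1.
    have -> : y = alpha1%:C; last by [].
    move: yrs; rewrite /rs; have -> : r = 1%N by apply/eqP; rewrite eqn_leq r1.
    by rewrite inE => /eqP ->.
  have cop : coprimep (map_poly intr P) (map_poly intr 'X : {poly R[i]}).
    by apply: irreducible_coprimep; rewrite ?polyX_eq0 // size_polyX deg_P.
  have := @coprimep_root _ _ _ y cop.
  by rewrite map_polyX hornerX; apply; rewrite rsP root_prod_XsubC.
have a1 : a 1%N != 0 by rewrite gt_eqF// a_gt0.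
have [_ [c [c0 ac]]] := exponential_form irr_P mP rsP rs0 annP a1.
have al1rs : alpha 1%N \in rs by apply: map_f; rewrite mem_index_iota.
pose C i := c (alpha i).
have aE n : (1 <= n)%N -> (a n)%:~R / alpha1%:C ^+ n =
    C 1%N + \sum_(2 <= i < r.+1) C i * (alpha i / alpha1%:C) ^+ n.
  move=> n1; rewrite ac// big_map big_ltn// mulrDl -alpha1E mulfK; last first.
    by rewrite expf_neq0// rs0.
  rewrite mulr_suml; congr (_ + _); apply: eq_bigr => i _.
  by rewrite exprMn exprVn mulrA.
have ratio i : (2 <= i < r.+1)%N -> `|alpha i / alpha1%:C| < 1.
  move=> ir; rewrite normrM normfV normC_real (gtr0_norm al0).
  by rewrite ltr_pdivrMr ?ltcR// mul1r; exact: dominant.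
pose V := [seq (C i, alpha i / alpha1%:C) | i <- index_iota 2 r.+1].
(* a n / alpha1^n is positive and tends to C 1. *)
have CR : 0 < C 1%N.
  have [p /mapP[i + ->]|th th01 hV] := @exists_ratio _ V.
    by rewrite mem_index_iota; exact: ratio.
  have th0 : 0 <= th by case/andP: th01 => /ltW.
  apply: (dominant_coef_gt0 (c0 _ al1rs) th01 (expsum_bounded th0 hV)) => n n0.
  rewrite /expsum big_map /= -aE// divr_ge0//.
    by rewrite -(rmorph_int (real_complex R)) ler0c ler0z ltW// a_gt0.
  by rewrite exprn_ge0// ler0c ltW.
pose c1 := complex.Re (C 1%N).
have c1E : C 1%N = c1%:C by rewrite RRe_real// gtr0_real.
have c1_gt0 : 0 < c1 by rewrite -ltcR -c1E.
pose U := ((x / c1)%:C, (alpha1^-1)%:C) ::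
  [seq (C i / C 1%N, alpha i / alpha1%:C) | i <- index_iota 2 r.+1].
have [p|th th01 hU] := @exists_ratio _ U.
  rewrite inE => /predU1P[->|/mapP[i + ->]] /=; last first.
    by rewrite mem_index_iota; exact: ratio.
  by rewrite normC_real gtr0_norm ?invr_gt0// -[1]/(1%:C) ltcR invf_lt1.
have aU n : (1 <= n)%N ->
    ((a n)%:~R + x)%:C = (c1 * alpha1 ^+ n)%:C * (1 + expsum U n).
  move=> n1; have c10 : C 1%N != 0 by exact: c0.
  have aln : alpha1%:C ^+ n != 0 :> R[i] by rewrite expf_neq0.
  have -> : ((a n)%:~R + x)%:C = (a n)%:~R + x%:C :> R[i].
    by rewrite rmorphD rmorph_int.
  rewrite rmorphM rmorphXn /= -c1E -[(a n)%:~R](divfK aln) aE//.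
  rewrite /expsum big_cons big_map /= fmorph_div /= -c1E fmorphV exprVn.
  have -> : \sum_(2 <= i < r.+1) C i / C 1%N * (alpha i / alpha1%:C) ^+ n =
      (\sum_(2 <= i < r.+1) C i * (alpha i / alpha1%:C) ^+ n) / C 1%N.
    by rewrite mulr_suml; apply: eq_bigr => i _; rewrite mulrAC.
  set S := \sum_(_ <= _ < _) _.
  by field; rewrite c10 aln.
move=> D.
have [cv hol [Phi [mer eqPhi poles]]] :=
  meromorphic_continuation s c1_gt0 al0 th01 hU aU.
split; [exact: cv|exact: hol|exists Phi; split; [exact: mer|exact: eqPhi|]].
move=> p n pn; have [n1 [k [w wU pE]]] := poles p n pn; split; first exact: n1.
have [|j [m]] := @monomial_exppow _ U (alpha1^-1)%:C r
  (fun i => alpha i / alpha1%:C) _ k w wU.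
  move=> q; rewrite inE => /predU1P[->|/mapP[i + ->]]; first by left.
  by rewrite mem_index_iota => ir; right; exists i.
move=> wE; have [k' [k'r k'E]] := @pole_pointE _ r alpha1 alpha s j m al0.
by exists j, k'; split; [exact: k'r|rewrite -k'E pE wE].
Qed.
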